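(* Let $\ell(\tilde y,y):=\mathbf{1}_{\tilde y\ne y}$ be the $0$-$1$ loss, $p\in(0,1)$, and $\Psi_p(t):=\min\{t/p,1\}$. Then for every $A\in\mathcal{A}$ $$\mathrm{ProbR}_{\Psi_p}(A)=\mathbb{E}_{(x,y)\sim\mu}\Big[\max\big\{\ell(\mathbf{1}_A(x),y),\ \mathrm{CVaR}_p\big(\ell(\mathbf{1}_A(\cdot),y);\mathfrak{m}_x\big)\big\}\Big].$$
   Context: Setting: $\mathcal{X}$ is a set, $\mathcal{A}\subset 2^{\mathcal{X}}$ a $\sigma$-algebra, and $\mu$ a probability measure on $(\mathcal{X}\times\{0,1\},\mathcal{A}\otimes 2^{\{0,1\}})$. For $i\in\{0,1\}$ put $\rho_i(B):=\mu(B\times\{i\})$, and $\rho:=\rho_0+\rho_1$. $\{\mathfrak{m}_x\}_{x\in\mathcal{X}}$ is a family such that $\mathfrak{m}_x$ is a probability measure on $(\mathcal{X},\mathcal{A})$ for $\rho$-almost every $x$, and $x\mapsto\mathfrak{m}_x(B)$ is measurable for every $B\in\mathcal{A}$. For $A\in\mathcal{A}$ (with $A^c=\mathcal{X}\setminus A$): $$\mathrm{ProbR}_\Psi(A):=\rho_0(A)+\rho_1(A^c)+\int_{A^c}\Psi(\mathfrak{m}_x(A))\,d\rho_0(x)+\int_{A}\Psi(\mathfrak{m}_x(A^c))\,d\rho_1(x).$$ For a measurable function $f:\mathcal{X}\to\mathbb{R}$ and a probability measure $\mathfrak{m}$, the conditional value at risk at level $p\in(0,1)$ is $$\mathrm{CVaR}_p(f;\mathfrak{m}):=\inf_{\alpha\in\mathbb{R}}\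 \alpha+\frac{\mathbb{E}_{x'\sim\mathfrak{m}}[(f(x')-\alpha)_+]}{p}.$$ *)

(* Defs.v *)
From HB Require Import structures.
From mathcomp Require Import all_boot all_order all_algebra.
From mathcomp Require Import all_classical all_reals all_analysis.
From mathcomp Require Import measurable_realfun.

Set Implicit Arguments.
Unset Strict Implicit.
Unset Printing Implicit Defensive.

Import Order.TTheory GRing.Theory Num.Theory.

Local Open Scope classical_set_scope.
Local Open Scope ring_scope.
Local Open Scope ereal_scope.

(* Labels are booleans: [false] is the label 0 and [true] is the label 1. *)

Section class_measure.
Context (d : measure_display) (X : measurableType d) (R : realType).
Variables (mu : probability (X * bool)%type R) (i : bool).

Definition rho_ (B : set X) : \bar R := mu (B `*` [set i]).

Let rho0 : rho_ set0 = 0.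
Proof. by rewrite /rho_ set0X measure0. Qed.

Let rho_ge0 (B : set X) : 0 <= rho_ B.
Proof. exact: measure_ge0. Qed.

Let rho_sigma_additive : semi_sigma_additive rho_.
Proof.
move=> F mF tF mUF; rewrite /rho_.
have -> : (\bigcup_n F n) `*` [set i] = \bigcup_n (F n `*` [set i]).
  apply/seteqP; split=> -[x y] /=.
    by move=> [[n _ Fx] yi]; exists n.
  by move=> [n _ [Fx yi]]; split=> //; exists n.
apply: measure_sigma_additive.
- by move=> n; apply: measurableX.
- move=> j k _ _ [[x y] /= [[Fjx _] [Fkx _]]].
  by apply: (tF j k) => //; exists x.
Qed.

HB.instance Definition _ := isMeasure.Build _ _ _ rho_
  rho0 rho_ge0 rho_sigma_additive.

End class_measure.

Definition rho (d : measure_display) (X : measurableType d) (R : realType)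
    (mu : probability (X * bool)%type R) : {measure set X -> \bar R} :=
  measure_add (rho_ mu false) (rho_ mu true).

(* A set function agrees with a probability measure on the sigma-algebra; its
   values on non-measurable sets are irrelevant. *)
Definition is_probability (d : measure_display) (X : measurableType d)
    (R : realType) (m : set X -> \bar R) : Prop :=
  exists P : probability X R, forall B, measurable B -> m B = P B.

(* [m x] is a bare set function because it need only be a probability measure
   for rho-almost every [x]; at those points [m x A] is a real number in [0, 1],
   so [fine] loses nothing. *)
Definition ProbR (d : measure_display) (X : measurableType d) (R : realType)
    (mu : probability (X * bool)%type R) (m : X -> set X -> \bar R)
    (Psi : R -> R) (A : set X) : \bar R :=
  rho_ mu false A + rho_ mu true (~` A)
  + \int[rho_ mu false]_(x in ~` A) (Psi (fine (m x A)))%:E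
  + \int[rho_ mu true]_(x in A) (Psi (fine (m x (~` A))))%:E.

Definition CVaR (d : measure_display) (X : measurableType d) (R : realType)
    (p : R) (f : X -> R) (m : set X -> \bar R) : \bar R :=
  ereal_inf [set alpha%:E + (\int[m]_x' (Num.max (f x' - alpha) 0)%:E) * p^-1%:E
            | alpha in [set: R]].

Definition loss01 (R : realType) (ytilde y : R) : R := (ytilde != y)%:R%R.

Definition Psi_ (R : realType) (p t : R) : R := Num.min (t / p)%R 1%R.

(* Main.v *)
(** For a fixed label [i], the loss [x' |-> loss01 (\1_A x') i] is the indicator
of the error set [T i] ([A] for label 0, its complement for label 1).  The CVaR
of an indicator under a probability is [Psi_ p] of the probability of the set:
[alpha + E[(\1_E - alpha)_+] / p] is nondecreasing on [alpha >= 1],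
nonincreasing on [alpha <= 0] because [p < 1], and affine in between, so its
minimum is attained at [alpha = 0] or [alpha = 1].  Hence the integrand is 1 on
[T i] and [Psi_ p (m_x (T i))] elsewhere, and splitting [mu] by labels gives the
four terms of [ProbR]. *)

Require Import Defs.
From mathcomp Require Import all_boot all_order all_algebra.
From mathcomp Require Import all_classical all_reals all_analysis.
From mathcomp Require Import measurable_realfun.
From mathcomp Require Import lra.

Import Order.TTheory GRing.Theory Num.Theory.
Import HBNNSimple.

Local Open Scope classical_set_scope.
Local Open Scope ring_scope.
Local Open Scope ereal_scope.

(** The integral is a supremum of integrals of simple functions, and these evaluate [m] only on
    level sets, which are measurable. This lets a bare set function be traded for the probability it
    agrees with. *)
Lemma integral_set_function_eq (d : measure_display) (X : measurableType d)
    (R : realType) (m : set X -> \bar R) (P : {measure set X -> \bar R})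
    (f : X -> \bar R) :
  (forall B, measurable B -> m B = P B) -> \int[m]_x f x = \int[P]_x f x.
Proof.
move=> mP.
have mPs (h : {nnsfun X >-> R}) : sintegral m h = sintegral P h.
  rewrite /sintegral; apply: eq_fsbigr => r _.
  by rewrite mP//; exact: measurable_sfunP.
rewrite /integral; congr (_ - _); congr (ereal_sup _);
  by apply: eq_imagel => h _; rewrite mPs.
Qed.

(** No measurability of [f] and [g]: a CVaR taken at a point [x] where [m x] is
not a probability depends on [x] arbitrarily. *)
Lemma ge0_le_integral_off_null (d : measure_display) (X : measurableType d)
    (R : realType) (mu : {measure set X -> \bar R}) (N : set X)
    (f g : X -> \bar R) :
  measurable N -> mu N = 0 -> (forall x, 0 <= f x) -> (forall x, 0 <= g x) ->
  (forall x, ~ N x -> f x <= g x) ->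
  \int[mu]_x f x <= \int[mu]_x g x.
Proof.
move=> mN N0 f0 g0 fg; rewrite !ge0_integralTE//.
apply: ge_ereal_sup => _ [h /= hf <-].
have mNC : measurable (~` N) by exact: measurableC.
(* Cutting [h] to zero on [N] gives a simple function below [g] everywhere, with the same integral
   since [N] is null. *)
apply: ereal_sup_ubound; exists (proj_nnsfun h mNC) => /=.
  move=> x; rewrite /mindic indicE; have [Nx|Nx] := pselect (N x).
    by rewrite memNset ?mulr0//=; exact.
  by rewrite mem_set//= mulr1 (le_trans (hf x))// fg.
rewrite -!integralT_nnsfun; apply: ae_eq_integral => //.
- exact/measurable_EFinP.
- exact/measurable_EFinP.
exists N; split => // x /=; apply: contra_notP => Nx _.
by rewrite /= /mindic indicE mem_set//= mulr1.
Qed.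

Lemma ge0_eq_integral_off_null (d : measure_display) (X : measurableType d)
    (R : realType) (mu : {measure set X -> \bar R}) (N : set X)
    (f g : X -> \bar R) :
  measurable N -> mu N = 0 -> (forall x, 0 <= f x) -> (forall x, 0 <= g x) ->
  (forall x, ~ N x -> f x = g x) ->
  \int[mu]_x f x = \int[mu]_x g x.
Proof.
move=> mN N0 f0 g0 fg; apply/eqP; rewrite eq_le; apply/andP; split;
  by apply: (@ge0_le_integral_off_null _ _ _ _ N) => // x /fg ->.
Qed.

Section cvar.
Context (d : measure_display) (X : measurableType d) (R : realType).
Variables (P : probability X R) (p : R) (E : set X).
Hypotheses (p_gt0 : (0 < p)%R) (p_lt1 : (p < 1)%R) (mE : measurable E).

Lemma integral_excess_indic (a : R) :
  \int[P]_x (Num.max (\1_E x - a) 0)%:E =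
  (Num.max (1 - a) 0 * fine (P E) + Num.max (- a) 0 * (1 - fine (P E)))%:E.
Proof.
have mEC : measurable (~` E) by exact: measurableC.
rewrite -(setUv E) ge0_integral_setU //; last 3 first.
- apply/measurable_EFinP; apply: measurable_maxr => //.
  by apply: measurable_funB => //; exact: measurable_indic.
- by move=> x _; rewrite lee_fin le_max lexx orbT.
- by apply/disj_setPS; rewrite setICr.
rewrite (eq_integral (cst (Num.max (1 - a) 0)%:E)); last first.
  by move=> x xE; rewrite /= indicE xE.
rewrite [X in _ + X](eq_integral (cst (Num.max (- a) 0)%:E)); last first.
  by move=> x; rewrite in_setC => /negbTE xE; rewrite /= indicE xE sub0r.
rewrite !integral_cst// [X in _ + _ * X](probability_setC P mE).
by rewrite EFinD !EFinM EFinB fineK// fin_num_measure.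
Qed.

Lemma CVaR_indic : CVaR p \1_E P = (Psi_ p (fine (P E)))%:E.
Proof.
rewrite /CVaR /Psi_.
have q0 : (0 <= fine (P E))%R by rewrite fine_ge0.
have q1 : (fine (P E) <= 1)%R.
  by rewrite -lee_fin fineK ?fin_num_measure// probability_le1.
set q := fine (P E) in q0 q1 *.
under eq_imagel do rewrite integral_excess_indic -/q -EFinM -EFinD.
apply/eqP; rewrite eq_le; apply/andP; split.
  have [qp|qp] := leP (q / p)%R 1%R.
    apply: ereal_inf_lbound; exists 0%R => //.
    by rewrite subr0 oppr0 maxxx max_l// mul1r mul0r addr0 add0r.
  apply: ereal_inf_lbound; exists 1%R => //.
  by rewrite subrr maxxx max_r ?lerN10// !mul0r addr0 mul0r addr0.
apply: le_ereal_inf_tmp => _ [a _ <-]; rewrite lee_fin ge_min.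
have p1 : (1 <= p^-1)%R by rewrite invf_ge1// ltW.
(* The objective is [a] itself for [a >= 1], the convex combination [a + (1 - a) * (q / p)] of 1 and
   [q / p] for [a] in [0, 1], and [q / p + a * (1 - p^-1)] for [a < 0], where both factors of the
   last product are nonpositive. *)
have [a1|a1] := leP 1%R a.
  rewrite !max_r ?subr_le0 ?oppr_le0 ?(le_trans ler01 a1)//.
  by rewrite !mul0r addr0 mul0r addr0 a1 orbT.
have a1' : (0 <= 1 - a)%R by rewrite subr_ge0 ltW.
rewrite (max_l a1'); have [a0|a0] := leP 0%R a.
  rewrite max_r ?oppr_le0//; apply/orP.
  by have [qp|qp] := leP (q / p)%R 1%R; [left|right]; nra.
by rewrite max_l ?oppr_ge0 ?(ltW a0)//; apply/orP; left; nra.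
Qed.

End cvar.

Section labels.
Context (d : measure_display) (X : measurableType d) (R : realType).
Variable mu : probability (X * bool)%type R.

Let measurable_slice (i : bool) (B : set (X * bool)) :
  measurable B -> measurable ((pair^~ i) @^-1` B).
Proof.
by move=> mB; rewrite -[X in measurable X]setTI; exact: pair2_measurable.
Qed.

Lemma measure_labels (B : set (X * bool)) : measurable B ->
  mu B = rho_ mu false ((pair^~ false) @^-1` B)
       + rho_ mu true ((pair^~ true) @^-1` B).
Proof.
move=> mB; rewrite /rho_ -measureU//; last 3 first.
- by apply: measurableX => //; exact: measurable_slice.
- by apply: measurableX => //; exact: measurable_slice.
- by apply/seteqP; split=> // -[x b] /= [[_ ->]] [].
congr (mu _); apply/seteqP; split=> -[x []] /=.
- by right.
- by left.
- by case=> -[].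
- by case=> -[].
Qed.

(** [mu] is the sum over the labels [i] of the pushforwards of [rho_ mu i] along [x |-> (x, i)], so
    a change of variables applies to each summand. *)
Lemma ge0_integral_labels (h : X * bool -> \bar R) :
  (forall z, 0 <= h z) -> measurable_fun setT h ->
  \int[mu]_z h z = \int[rho_ mu false]_x h (x, false)
                 + \int[rho_ mu true]_x h (x, true).
Proof.
move=> h0 mh.
have mpair (i : bool) : measurable_fun setT (fun x : X => (x, i)).
  exact: pair2_measurable.
pose nu i : {measure set (X * bool) -> \bar R} :=
  measure_function_pushforward__canonical__measure_function_Measure
    (rho_ mu i) (mpair i).
rewrite (eq_measure_integral (measure_add (nu false) (nu true))); last first.
  by move=> B mB _; rewrite [LHS]measure_labels// [RHS]measure_addE.
rewrite ge0_integral_measure_add//.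
by congr (_ + _); rewrite ge0_integral_pushforward.
Qed.

Lemma rho_null (N : set X) : rho mu N = 0 ->
  forall i, rho_ mu i N = 0.
Proof.
have -> : rho mu N = rho_ mu false N + rho_ mu true N by exact: measure_addE.
move=> /eqP.
by rewrite padde_eq0 ?measure_ge0// => /andP[/eqP N0 /eqP N1] [].
Qed.

End labels.

Lemma loss01_indic (X : Type) (R : realType) (A : set X) (i : bool) (x : X) :
  loss01 (\1_A x) i%:R = \1_(if i then ~` A else A) x :> R.
Proof.
rewrite /loss01; case: i; rewrite !indicE ?in_setC; case: (x \in A) => //=;
  by rewrite ?eqxx ?oner_eq0 // eq_sym oner_eq0.
Qed.

Lemma Psi_ge0 (R : realType) (p t : R) :
  (0 < p -> 0 <= t -> 0 <= Psi_ p t)%R.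
Proof. by move=> p0 t0; rewrite le_min divr_ge0// ltW. Qed.

Theorem proposition3 (R : realType) (d : measure_display)
    (X : measurableType d) (mu : probability (X * bool)%type R)
    (m : X -> set X -> \bar R)
    (m_prob : {ae rho mu, forall x, is_probability (m x)})
    (m_meas : forall B : set X, measurable B ->
       measurable_fun [set: X] (m ^~ B))
    (p : R) (p_gt0 : (0 < p)%R) (p_lt1 : (p < 1)%R)
    (A : set X) (mA : measurable A) :
  ProbR mu m (Psi_ p) A =
  \int[mu]_z
    maxe (loss01 (\1_A z.1) (z.2)%:R)%:E
         (CVaR p (fun x' => loss01 (\1_A x') (z.2)%:R) (m z.1)).
Proof.
case: m_prob => N [mN N0 Nprob].
have mP x : ~ N x -> exists P : probability X R,
    forall B, measurable B -> m x B = P B.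
  by move=> Nx; apply: contrapT => /Nprob.
have rhoN := rho_null _ _ _ _ _ N0.
pose T (i : bool) := if i then ~` A else A.
have mT i : measurable (T i) by case: i => //; exact: measurableC.
(* The absolute value, void off the null set [N], makes [g] below nonnegative
   everywhere while keeping it measurable. *)
pose psi i x := `|Psi_ p (fine (m x (T i)))|%R.
have psiE i x : ~ N x -> psi i x = Psi_ p (fine (m x (T i))).
  move=> /mP[P mxP]; rewrite /psi ger0_norm// Psi_ge0// fine_ge0//.
  by rewrite mxP//.
have mPsi i : measurable_fun setT (fun x => Psi_ p (fine (m x (T i)))).
  apply: measurable_minr => //; apply: measurable_funM => //.
  by apply: measurableT_comp => //; exact: m_meas.
have mpsi i : measurable_fun setT (psi i) by exact: measurableT_comp.
(* [g] is a measurable substitute for the integrand, equal to it off [N * bool]; only a measurable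
   function can be split by labels. *)
pose g (z : X * bool) : \bar R :=
  (if z.1 \in T z.2 then 1 else psi z.2 z.1)%:E.
have g0 z : 0 <= g z.
  by rewrite /g lee_fin; case: ifP => _ //; exact: normr_ge0.
have mgi i : measurable_fun setT (fun x => g (x, i)).
  apply/measurable_EFinP; apply: measurable_fun_ifT => //; last exact: mpsi.
  apply: (@measurable_fun_bool _ _ _ _ true); rewrite setTI.
  have -> // : (fun x => x \in T i) @^-1` [set true] = T i.
  by apply/seteqP; split=> x /=; [exact: set_mem|exact: mem_set].
have mg : measurable_fun setT g.
  apply: (eq_measurable_fun
    (fun z => if z.2 then g (z.1, true) else g (z.1, false))).
    by move=> -[x []].
  apply: measurable_fun_ifT; first exact: measurable_snd.
  - exact: (measurableT_comp (mgi true) measurable_fst).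
  - exact: (measurableT_comp (mgi false) measurable_fst).
have intg i : \int[rho_ mu i]_x g (x, i) = rho_ mu i (T i) +
    \int[rho_ mu i]_(x in ~` T i) (Psi_ p (fine (m x (T i))))%:E.
  have mTC : measurable (~` T i) by exact: measurableC.
  rewrite -(setUv (T i)) ge0_integral_setU//; last 2 first.
  - by rewrite setUv.
  - by apply/disj_setPS; rewrite setICr.
  congr (_ + _).
    rewrite (eq_integral (cst 1)) ?integral_cst ?mul1e// => x xT.
    by rewrite /g /= xT.
  (* Off [T i], [g] is [psi], which can differ from [Psi_ p] only on the null set [N]. *)
  apply: ae_eq_integral => //.
  - exact: measurable_funTS.
  - by apply/measurable_EFinP; exact: measurable_funTS.
  exists N; split; [exact: mN|exact: rhoN|move=> x /=].
  apply: contra_notP => Nx Tx.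
  by rewrite /g /= memNset// psiE.
rewrite (@ge0_eq_integral_off_null _ _ _ mu (N `*` setT) _ g).
- rewrite ge0_integral_labels// !intg /ProbR /T setCK.
  by rewrite [RHS]addeACA; exact/esym/addeA.
- exact: measurableX.
- rewrite [LHS]measure_labels//; last exact: measurableX.
  have slice i : (pair^~ i) @^-1` (N `*` [set: bool]) = N.
    by apply/seteqP; split=> x //= [].
  by rewrite !slice !rhoN adde0.
(* The loss in the maximum gives nonnegativity even over [N], where the CVaR is uncontrolled. *)
- by move=> z; rewrite le_max lee_fin /loss01 ler0n.
- exact: g0.
move=> [x i] /= /not_andP[Nx|//]; have [P mxP] := mP _ Nx.
have -> : (fun x' => loss01 (\1_A x') i%:R) = \1_(T i) :> (X -> R).
  by apply/funext => x'; exact: loss01_indic.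
have -> : CVaR p \1_(T i) (m x) = CVaR p \1_(T i) P.
  congr ereal_inf; apply: eq_imagel => a _.
  by rewrite (integral_set_function_eq _ _ _ _ _ _ mxP).
rewrite CVaR_indic// loss01_indic -/(T i) indicE /g /= -mxP//.
(* On [T i] the loss 1 dominates because [Psi_ p] is at most 1; elsewhere the loss is 0 and the CVaR
   dominates. *)
case: ifPn => xT; first by rewrite max_l// lee_fin ge_min lexx orbT.
by rewrite -psiE// max_r// lee_fin; exact: normr_ge0.
Qed.
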